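(* Let $A \in \mathbb{R}^{m\times m}$ be a nonsingular matrix, $K=A\mathbb{R}^m_+$ the corresponding simplicial cone, and $z\in\mathbb{R}^m$ arbitrary. Suppose that $\|A^\top A-I\|<1$. Then, for any starting point $x_0\in\mathbb{R}^m$, the sequence $\{x_k\}$ defined by $$x_{k+1}=-\left(A^\top A-I\right)x_k^+ + A^\top z,\qquad k=0,1,2,\ldots,$$ converges to the unique solution $u\in\mathbb{R}^m$ of the equation $$\left(A^\top A-I\right)x^+ + x = A^\top z,$$ one has $P_K(z)=Au^+$, and the following error bound holds: $$\|u-x_k\|\le \frac{\|A^\top A-I\|}{1-\|A^\top A-I\|}\,\|x_k-x_{k-1}\|,\qquad k=1,2,\ldots.$$ Moreover, $\{x_k\}$ converges linearly to $u$ in the sense that $$\|u-x_{k+1}\|\le \|A^\top A-I\|\,\|u-x_k\|,\qquad k=0,1,2,\ldots.$$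
   Context: $\mathbb{R}^m$ carries the canonical scalar product $\langle\cdot,\cdot\rangle$ and the induced Euclidean norm $\|\cdot\|$. For $M\in\mathbb{R}^{m\times m}$, $\|M\|:=\max\{\|Mx\| : x\in\mathbb{R}^m,\ \|x\|=1\}$. $I$ is the $m\times m$ identity matrix. For $x=(x^1,\dots,x^m)\in\mathbb{R}^m$, $x^+:=(\max\{x^1,0\},\dots,\max\{x^m,0\})$. $\mathbb{R}^m_+$ is the nonnegative orthant, the set of vectors with all components $\ge 0$. For a nonsingular $A\in\mathbb{R}^{m\times m}$, the simplicial cone is $K=A\mathbb{R}^m_+:=\{Ax : x\in\mathbb{R}^m_+\}$. $P_K(z):=\operatorname{argmin}\{\|z-y\| : y\in K\}$ is the projection of $z$ onto $K$. *)

(* Defs.v *)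
From HB Require Import structures.
From mathcomp Require Import all_boot all_order all_algebra.
From mathcomp Require Import all_classical all_reals all_analysis.

Set Implicit Arguments.
Unset Strict Implicit.
Unset Printing Implicit Defensive.

Import Order.TTheory GRing.Theory Num.Theory.
Import numFieldTopology.Exports numFieldNormedType.Exports.

Local Open Scope classical_set_scope.
Local Open Scope ring_scope.

Definition dotv (R : realType) (m : nat) (x y : 'cV[R]_m) : R :=
  \sum_(i < m) x i 0 * y i 0.

(* Not the library norm [`|x|] of 'cV[R]_m, which is the sup norm. *)
Definition enorm (R : realType) (m : nat) (x : 'cV[R]_m) : R :=
  Num.sqrt (dotv x x).

(* The supremum is a maximum as soon as 0 < m: see [opnorm_max] below.
   For m = 0 the unit sphere is empty and opnorm M = sup set0 = 0. *)
Definition opnorm (R : realType) (m : nat) (M : 'M[R]_m) : R :=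
  sup [set enorm (M *m x) | x in [set x : 'cV[R]_m | enorm x = 1]].

Definition pospart (R : realType) (m : nat) (x : 'cV[R]_m) : 'cV[R]_m :=
  \col_(i < m) Num.max (x i 0) 0.

Definition orthant (R : realType) (m : nat) : set 'cV[R]_m :=
  [set x | forall i, 0 <= x i 0].

Definition simplicial_cone (R : realType) (m : nat) (A : 'M[R]_m) :
    set 'cV[R]_m :=
  [set A *m x | x in @orthant R m].

(* The set of all minimizers; "P_K(z) = p" reads [projection K z = [set p]],
   which includes the uniqueness of the nearest point. *)
Definition projection (R : realType) (m : nat) (K : set 'cV[R]_m)
    (z : 'cV[R]_m) : set 'cV[R]_m :=
  [set p | K p /\ forall y, K y -> enorm (z - p) <= enorm (z - y)].

Section OpnormMax.
Context {R : realType}.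

Lemma enorm_continuous n m (f : 'rV[R]_n -> 'cV[R]_m) :
  (forall i, continuous (fun x => f x i 0)) ->
  continuous (fun x => enorm (f x)).
Proof.
move=> fc x; apply: (@continuous_comp _ _ _ (fun x => dotv (f x) (f x))).
  apply: (continuous_big (@add_continuous R)) => i _ y.
  by apply: (@continuousM R _ (fun x => f x i 0) (fun x => f x i 0)); exact: fc.
exact: sqrt_continuous.
Qed.

Lemma trmx_coord_continuous n i : continuous (fun x : 'rV[R]_n => x^T i 0).
Proof.
rewrite (_ : (fun _ => _) = (fun x : 'rV[R]_n => x 0 i)).
  exact: coord_continuous.
by apply/funext => x; rewrite mxE.
Qed.

Lemma opnorm_max m (M : 'M[R]_m) : (0 < m)%N ->
  exists2 x : 'cV[R]_m, enorm x = 1 &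
    enorm (M *m x) = opnorm M /\
    forall y : 'cV[R]_m, enorm y = 1 -> enorm (M *m y) <= enorm (M *m x).
Proof.
move=> m0; pose S : set 'rV[R]_m := [set x | enorm x^T = 1].
have cS : compact S.
  apply: bounded_closed_compact.
    exists 1; split => // r r1 x Sx /=.
    apply: (le_trans _ (ltW r1)).
    rewrite [leLHS]mx_normrE; apply: bigmax_le => // -[i j] _ /=.
    rewrite -Sx /enorm -sqrtr_sqr ler_sqrt; last first.
      by apply: sumr_ge0 => k _; rewrite -expr2 sqr_ge0.
    rewrite /dotv (bigD1 j) //= !mxE (ord1 i) -expr2 lerDl.
    by apply: sumr_ge0 => k _; rewrite -expr2 sqr_ge0.
  rewrite (_ : S = (fun x : 'rV[R]_m => enorm x^T) @^-1` [set 1]) //.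
  apply: preimage_closed; last exact: closed_eq.
  move=> x _; apply: enorm_continuous => i.
  exact: trmx_coord_continuous.
have S0 : S !=set0.
  exists (delta_mx 0 (Ordinal m0)); rewrite /S /= /enorm /dotv.
  rewrite (bigD1 (Ordinal m0)) //= big1 => [|i im].
    by rewrite !mxE !eqxx mul1r addr0 sqrtr1.
  by rewrite !mxE (negbTE im) andbF mul0r.
have [|x Sx xmax] := @EVT_max_rV R m (fun x => enorm (M *m x^T)) S S0 cS.
  apply/continuous_subspaceT/enorm_continuous => i.
  have -> : (fun x : 'rV[R]_m => (M *m x^T) i 0) =
            (fun x => \sum_j M i j * x^T j 0).
    by apply/funext => x; rewrite mxE.
  apply: (continuous_big (@add_continuous R)) => j _ y.
  apply: (@continuousM R _ (fun=> M i j) (fun x : 'rV[R]_m => x^T j 0)).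
    exact: cst_continuous.
  exact: trmx_coord_continuous.
have ub (y : 'cV[R]_m) : enorm y = 1 -> enorm (M *m y) <= enorm (M *m x^T).
  move=> y1; rewrite -[y]trmxK; apply: xmax.
  by rewrite inE /S /= trmxK.
move: Sx; rewrite inE => Sx.
exists x^T => //; split => //.
apply/eqP; rewrite eq_le; apply/andP; split.
  apply: ub_le_sup; last by exists x^T.
  by exists (enorm (M *m x^T)) => _ [y y1 <-]; exact: ub.
apply: ge_sup; first by exists (enorm (M *m x^T)), x^T.
by move=> _ [y y1 <-]; exact: ub.
Qed.

End OpnormMax.

(* Main.v *)
Require Import Defs.
From HB Require Import structures.
From mathcomp Require Import all_boot all_order all_algebra.
From mathcomp Require Import all_classical all_reals all_analysis.
From mathcomp Require Import ring lra.
Import Order.TTheory GRing.Theory Num.Theory.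
Import numFieldTopology.Exports numFieldNormedType.Exports.
Local Open Scope classical_set_scope.
Local Open Scope ring_scope.

(** Write [B] for the matrix [A^T A - I] and [f x] for [- B x^+ + A^T z], so
    that the iteration is [x_(k+1) = f x_k] and the solutions of the equation
    are the fixed points of [f].

    The map [x |-> x^+] is nonexpansive for the Euclidean norm
    ([pospart_nonexpansive]), because the real function [max(., 0)] is
    1-Lipschitz and the norm is monotone in the absolute values of the
    coordinates.  Composing with [B] multiplies distances by at most the
    operator norm [q] of [B] ([enorm_mulmx]), so [f] is a [q]-contraction with
    [q < 1].  Existence and uniqueness of the fixed point [u], convergence of
    the iterates, the linear rate and the a posteriori error bound are then the
    conclusions of Banach's contraction principle.  The principle is proved
    here for the Euclidean norm ([enorm_contraction_fixpoint]), since a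
    contraction for that norm need not be one for the sup norm that the
    type of matrices carries.

    That [A u^+] is the projection of [z] is an optimality condition
    ([projection_simplicial_cone]).  The equation says
    [A^T (z - A u^+) = u - u^+], the opposite of the negative part of [u]: it
    is nonpositive and orthogonal to [u^+], hence [<z - A u^+, p - A u^+> <= 0]
    for every [p] in the cone, which is the variational characterization of
    the nearest point. *)

(** * Euclidean norm and operator norm *)

Section Euclidean.
Context {R : realType} {m : nat}.
Implicit Types (x y z : 'cV[R]_m) (M : 'M[R]_m).

Lemma dotv_mulmx x y : dotv x y = (x^T *m y) 0 0.
Proof. by rewrite /dotv mxE; apply: eq_bigr => i _; rewrite mxE. Qed.

Lemma dotvC x y : dotv x y = dotv y x.
Proof. by apply: eq_bigr => i _; rewrite mulrC. Qed.

Lemma dotvDr x y z : dotv x (y + z) = dotv x y + dotv x z.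
Proof. by rewrite !dotv_mulmx mulmxDr mxE. Qed.

Lemma dotvNr x y : dotv x (- y) = - dotv x y.
Proof. by rewrite !dotv_mulmx mulmxN mxE. Qed.

Lemma dotvZr a x y : dotv x (a *: y) = a * dotv x y.
Proof. by rewrite !dotv_mulmx -scalemxAr mxE. Qed.

Lemma dotv_trmx M x y : dotv (M *m x) y = dotv x (M^T *m y).
Proof. by rewrite !dotv_mulmx trmx_mul mulmxA. Qed.

Lemma dotvv_ge0 x : 0 <= dotv x x.
Proof. by apply: sumr_ge0 => i _; rewrite -expr2 sqr_ge0. Qed.

Lemma enorm_ge0 x : 0 <= enorm x.
Proof. exact: sqrtr_ge0. Qed.

Lemma sqr_enorm x : enorm x ^+ 2 = dotv x x.
Proof. by rewrite sqr_sqrtr ?dotvv_ge0. Qed.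

Lemma enorm0 : enorm (0 : 'cV[R]_m) = 0.
Proof. by rewrite /enorm dotv_mulmx mulmx0 mxE sqrtr0. Qed.

Lemma enormZ a x : enorm (a *: x) = `|a| * enorm x.
Proof.
by rewrite /enorm dotvZr dotvC dotvZr mulrA -expr2 sqrtrM ?sqr_ge0 ?sqrtr_sqr.
Qed.

Lemma enormN x : enorm (- x) = enorm x.
Proof. by rewrite -scaleN1r enormZ normrN1 mul1r. Qed.

Lemma enorm_distC x y : enorm (x - y) = enorm (y - x).
Proof. by rewrite -enormN opprB. Qed.

Lemma coord_le_enorm x i : `|x i 0| <= enorm x.
Proof.
rewrite -sqrtr_sqr ler_sqrt ?dotvv_ge0// /dotv (bigD1 i)//= -expr2 lerDl.
by apply: sumr_ge0 => j _; rewrite -expr2 sqr_ge0.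
Qed.

Lemma enorm_eq0 x : enorm x = 0 -> x = 0.
Proof.
move=> x0; apply/colP => i; rewrite mxE; apply/eqP.
by rewrite -normr_le0 -x0 coord_le_enorm.
Qed.

Lemma sqr_enormB x y :
  enorm (x - y) ^+ 2 = enorm x ^+ 2 - 2 * dotv x y + enorm y ^+ 2.
Proof.
rewrite !sqr_enorm dotvDr dotvNr [dotv (x - y) x]dotvC [dotv (x - y) y]dotvC.
by rewrite !dotvDr !dotvNr [dotv y x]dotvC; ring.
Qed.

(** Cauchy-Schwarz, by expanding the square of the norm of
    [|y| x - |x| y], which vanishes in the case of equality. *)
Lemma dotv_le_enorm x y : dotv x y <= enorm x * enorm y.
Proof.
have [/enorm_eq0 ->|x0] := eqVneq (enorm x) 0.
  by rewrite dotvC dotv_mulmx mulmx0 mxE enorm0 mul0r.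
have [/enorm_eq0 ->|y0] := eqVneq (enorm y) 0.
  by rewrite dotv_mulmx mulmx0 mxE enorm0 mulr0.
have xy_gt0 : 0 < enorm x * enorm y.
  by rewrite mulr_gt0// lt_neqAle eq_sym ?x0 ?y0 enorm_ge0.
have := sqr_ge0 (enorm (enorm y *: x - enorm x *: y)).
rewrite sqr_enormB !enormZ !ger0_norm ?enorm_ge0// dotvZr dotvC dotvZr dotvC.
by move=> h; rewrite -(ler_pM2l xy_gt0); nra.
Qed.

Lemma ler_enormD x y : enorm (x + y) <= enorm x + enorm y.
Proof.
rewrite -(@ler_pXn2r _ 2)// ?nnegrE ?addr_ge0 ?enorm_ge0//.
rewrite -{1}[y]opprK sqr_enormB dotvNr enormN.
by have := dotv_le_enorm x y; nra.
Qed.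

Lemma ler_enorm_dist y x z : enorm (x - z) <= enorm (x - y) + enorm (y - z).
Proof. by rewrite -[x - z](subrKA y) ler_enormD. Qed.

Lemma ler_enorm x y : (forall i, `|x i 0| <= `|y i 0|) -> enorm x <= enorm y.
Proof.
move=> xy; rewrite ler_sqrt ?dotvv_ge0//; apply: ler_sum => i _.
rewrite -!expr2 -(real_normK (num_real (x i 0))).
by rewrite -(real_normK (num_real (y i 0))) ler_pXn2r// nnegrE.
Qed.

(** By homogeneity from the unit sphere, on which the supremum defining the
    operator norm is attained. *)
Lemma enorm_mulmx M x : enorm (M *m x) <= opnorm M * enorm x.
Proof.
have [/enorm_eq0 ->|x0] := eqVneq (enorm x) 0.
  by rewrite mulmx0 enorm0 mulr0.
have x_gt0 : 0 < enorm x by rewrite lt_neqAle eq_sym x0 enorm_ge0.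
(* In dimension 0 there is no vector of nonzero norm. *)
have m_gt0 : (0 < m)%N.
  rewrite lt0n; apply: contra_neq x0 => m0.
  suff -> : x = 0 by exact: enorm0.
  by apply/colP => -[i im]; exfalso; rewrite m0 in im.
have [e _ [<- emax]] := opnorm_max M m_gt0.
have /emax : enorm ((enorm x)^-1 *: x) = 1.
  by rewrite enormZ ger0_norm ?invr_ge0 ?enorm_ge0// mulVf.
rewrite -scalemxAr enormZ ger0_norm ?invr_ge0 ?enorm_ge0//.
by rewrite mulrC ler_pdivrMr.
Qed.

(** A unit vector exists unless [m = 0], in which case the operator norm is
    the supremum of the empty set, that is 0. *)
Lemma opnorm_ge0 M : 0 <= opnorm M.
Proof.
have [[x x1]|noS] := pselect (exists x : 'cV[R]_m, enorm x = 1).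
  apply: le_trans (enorm_ge0 (M *m x)) _.
  by rewrite -[leRHS]mulr1 -x1 enorm_mulmx.
rewrite /opnorm (_ : [set _ | _ in _] = set0) ?sup0//.
by apply/seteqP; split => // _ [x /= x1 _]; apply: noS; exists x.
Qed.

Lemma pospart_nonexpansive x y : enorm (pospart x - pospart y) <= enorm (x - y).
Proof.
apply: ler_enorm => i; rewrite !mxE.
have [a0|a0] := leP (x i 0) 0; have [b0|b0] := leP (y i 0) 0.
- by rewrite subrr normr0.
- rewrite sub0r normrN gtr0_norm// ler0_norm; lra.
- rewrite subr0 gtr0_norm// ger0_norm; lra.
- exact: lexx.
Qed.

End Euclidean.

(** * Convergence and the contraction principle *)

Section Convergence.
Context {R : realType} {m : nat}.
Implicit Types (u : 'cV[R]_m) (x : nat -> 'cV[R]_m).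

(** The topology of ['cV[R]_m] is that of the sup norm; this lemma and the next
    one make the link with Euclidean distances. *)
Lemma enorm_cvg x u : enorm (u - x k) @[k --> \oo] --> (0 : R) -> x @ \oo --> u.
Proof.
move=> /cvgrPdist_lt xu; apply/cvg_ballP => e e0.
near=> k; split=> // i j; rewrite (ord1 j) /ball /=.
have -> : u i 0 - x k i 0 = (u - x k) i 0 by rewrite !mxE.
apply: le_lt_trans (coord_le_enorm _ _) _.
rewrite -[ltLHS]ger0_norm ?enorm_ge0// -normrN -sub0r.
by near: k; exact: xu.
Unshelve. all: by end_near. Qed.

Lemma coord_cvg_enorm x u :
  (forall i, x k i 0 @[k --> \oo] --> u i 0) ->
  enorm (u - x k) @[k --> \oo] --> (0 : R).
Proof.
move=> xu; have -> : 0 = enorm (u - u) by rewrite subrr enorm0.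
apply: (@cvg_comp _ _ _ (fun k => dotv (u - x k) (u - x k)) Num.sqrt);
  last exact: sqrt_continuous.
apply: cvg_big => [|i _]; first exact: add_continuous.
have uxi : (u - x k) i 0 @[k --> \oo] --> (u - u) i 0.
  under eq_fun do rewrite !mxE.
  rewrite !mxE.
  by apply: cvgB; [exact: cvg_cst|exact: xu].
exact: cvgM.
Qed.

(** The sequence is its initial term plus the sum of its increments, and this
    series is dominated by a geometric one. *)
Lemma geometric_step_cvg (a : nat -> R) (C q : R) : 0 <= q < 1 ->
  (forall k, `|a k.+1 - a k| <= C * q ^+ k) -> cvgn a.
Proof.
move=> /andP[q0 q1] ha.
have -> : a = (fun n => a 0%N + series (telescope a) n).
  by apply/funext => n; exact: eq_sum_telescope.
apply: is_cvgD; first exact: is_cvg_cst.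
apply: normed_cvg; apply: (@series_le_cvg _ _ (geometric C q)).
- by move=> k; exact: normr_ge0.
- by move=> k; apply: le_trans (normr_ge0 _) (ha k).
- exact: ha.
- by apply: is_cvg_geometric_series; rewrite ger0_norm.
Qed.

(** The iterates of [f] from 0 have geometrically decreasing steps, so each of
    their coordinates converges.  Their limit [u] is a fixed point because
    [|f u - u| <= |f u - x_(k+1)| + |x_(k+1) - u| <= q |u - x_k| + |u - x_(k+1)|]
    tends to 0. *)
Lemma enorm_contraction_fixpoint (f : 'cV[R]_m -> 'cV[R]_m) (q : R) :
  0 <= q < 1 ->
  (forall v w, enorm (f v - f w) <= q * enorm (v - w)) -> exists u, f u = u.
Proof.
move=> q01 fq; pose x k := iter k f 0.
have /andP[q0 q1] := q01.
have step k : enorm (x k.+1 - x k) <= enorm (x 1%N - x 0%N) * q ^+ k.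
  elim: k => [|k ih]; first by rewrite expr0 mulr1.
  apply: le_trans (fq _ _) _.
  by rewrite exprS mulrCA ler_wpM2l.
have cx i : cvgn (fun k => x k i 0).
  apply: geometric_step_cvg q01 _ => k.
  apply: le_trans _ (step k).
  have -> : x k.+1 i 0 - x k i 0 = (x k.+1 - x k) i 0 by rewrite !mxE.
  exact: coord_le_enorm.
pose u := \col_i limn (fun k => x k i 0).
have xu : enorm (u - x k) @[k --> \oo] --> (0 : R).
  by apply: coord_cvg_enorm => i; rewrite mxE; exact: cx.
exists u; apply/eqP; rewrite -subr_eq0; apply/eqP/enorm_eq0/eqP.
rewrite eq_le enorm_ge0 andbT.
have : (q * enorm (u - x k) + enorm (u - x k.+1)) @[k --> \oo]
    --> q * 0 + (0 : R).
  apply: cvgD; first by apply: cvgM => //; exact: cvg_cst.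
  by move: xu; rewrite -cvg_shiftS.
rewrite mulr0 addr0 => h.
rewrite -(cvg_lim _ h)//; apply: limr_ge; first by apply: cvgP h.
near=> k; apply: le_trans (ler_enorm_dist (x k.+1) _ _) _.
by rewrite [enorm (x k.+1 - u)]enorm_distC lerD2r fq.
Unshelve. all: by end_near. Qed.

End Convergence.

(** * Projection onto the cone *)

(** The identity [A^T (z - A u^+) = u - u^+] ([grad] below) makes the angle at
    [A u^+] between [z] and any point of the cone at least a right one; the
    resulting Pythagorean inequality ([pyth]) gives both minimality of
    [A u^+] and uniqueness of the minimizer. *)
Lemma projection_simplicial_cone (R : realType) (m : nat) (A : 'M[R]_m)
    (z u : 'cV[R]_m) :
  (A^T *m A - 1%:M) *m pospart u + u = A^T *m z ->
  projection (simplicial_cone A) z = [set A *m pospart u].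
Proof.
move=> hu.
have Kp : simplicial_cone A (A *m pospart u).
  by exists (pospart u) => // i; rewrite mxE le_max lexx orbT.
have grad : A^T *m (z - A *m pospart u) = u - pospart u.
  rewrite mulmxBr -hu mulmxBl mul1mx mulmxA; set a := _ *m _.
  by rewrite addrAC [a - _]addrC addrK addrC.
have pyth y : orthant y ->
  enorm (z - A *m pospart u) ^+ 2 + enorm (A *m y - A *m pospart u) ^+ 2
    <= enorm (z - A *m y) ^+ 2.
  move=> y0.
  have -> : z - A *m y = (z - A *m pospart u) - (A *m y - A *m pospart u).
    by rewrite opprB addrA subrK.
  rewrite [leRHS]sqr_enormB.
  (* By [grad] the inner product is the sum of the
     [(y_i - u_i^+) (u_i - u_i^+)]: such a term is [y_i u_i <= 0] if
     [u_i <= 0], and 0 otherwise. *)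
  suff : dotv (z - A *m pospart u) (A *m y - A *m pospart u) <= 0 by lra.
  rewrite -mulmxBr dotvC dotv_trmx grad; apply: sumr_le0 => i _.
  rewrite !mxE; have := y0 i; have [ui|ui] := leP (u i 0) 0 => yi; nra.
have min y : simplicial_cone A y ->
    enorm (z - A *m pospart u) <= enorm (z - y).
  move=> [v v0 <-]; rewrite -(@ler_pXn2r _ 2)// ?nnegrE ?enorm_ge0//.
  by apply: le_trans _ (pyth _ v0); rewrite lerDl sqr_ge0.
apply/seteqP; split => [p [[v v0 <-] pmin]|_ ->]; last by split.
apply/eqP; rewrite -subr_eq0; apply/eqP/enorm_eq0/eqP.
rewrite -sqrf_eq0 eq_le sqr_ge0 andbT.
have := pyth _ v0; have := pmin _ Kp.
rewrite -(@ler_pXn2r _ 2)// ?nnegrE ?enorm_ge0//; lra.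
Qed.

(** * Convergence of the iteration *)

Theorem theorem3 (R : realType) (m : nat) (A : 'M[R]_m) (z : 'cV[R]_m)
    (hA : A \in unitmx)
    (hlt : opnorm (A^T *m A - 1%:M) < 1) :
  exists u : 'cV[R]_m,
    [/\ unique (fun x : 'cV[R]_m =>
          (A^T *m A - 1%:M) *m pospart x + x = A^T *m z) u,
        projection (simplicial_cone A) z = [set A *m pospart u] &
        forall (x0 : 'cV[R]_m) (x : nat -> 'cV[R]_m),
          x 0%N = x0 ->
          (forall k : nat,
             x k.+1 = - (A^T *m A - 1%:M) *m pospart (x k) + A^T *m z) ->
          [/\ x @ \oo --> u,
              forall k : nat, (1 <= k)%N ->
                enorm (u - x k) <=
                  opnorm (A^T *m A - 1%:M) / (1 - opnorm (A^T *m A - 1%:M))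
                  * enorm (x k - x k.-1) &
              forall k : nat,
                enorm (u - x k.+1) <=
                  opnorm (A^T *m A - 1%:M) * enorm (u - x k)]].
Proof.
set B := A^T *m A - 1%:M in hlt *; set q := opnorm B in hlt *.
have q0 : 0 <= q := opnorm_ge0 B.
have q01 : 0 <= q < 1 by rewrite q0.
pose f (x : 'cV[R]_m) : 'cV[R]_m := - B *m pospart x + A^T *m z.
have fq x y : enorm (f x - f y) <= q * enorm (x - y).
  rewrite /f [X in _ - X]addrC addrKA -mulmxBr mulNmx enormN.
  apply: le_trans (enorm_mulmx _ _) _.
  by rewrite ler_wpM2l// pospart_nonexpansive.
have fixE x : (B *m pospart x + x = A^T *m z) <-> f x = x.
  rewrite /f mulNmx; split => [<-|e]; first by rewrite addKr.
  by rewrite -[X in _ + X]e addNKr.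
have [u fu] := enorm_contraction_fixpoint _ _ q01 fq.
exists u; split.
- split; first exact/fixE.
  move=> v /fixE fv; apply/eqP; rewrite -subr_eq0; apply/eqP/enorm_eq0/eqP.
  rewrite eq_le enorm_ge0 andbT; have := fq u v.
  by rewrite fu fv; have := enorm_ge0 (u - v); nra.
- exact/projection_simplicial_cone/fixE.
move=> x0 x _ xS.
have lin k : enorm (u - x k.+1) <= q * enorm (u - x k).
  by rewrite xS -[X in enorm (X - _)]fu fq.
split=> //.
- apply: enorm_cvg.
  have geo k : enorm (u - x k) <= enorm (u - x 0%N) * q ^+ k.
    elim: k => [|k ih]; first by rewrite expr0 mulr1.
    by apply: le_trans (lin k) _; rewrite exprS mulrCA ler_wpM2l.
  apply: (@squeeze_cvgr _ _ _ _ (fun=> 0) (geometric (enorm (u - x 0%N)) q)).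
  + by near=> k; rewrite enorm_ge0 geo.
  + exact: cvg_cst.
  + by apply: cvg_geometric; rewrite ger0_norm.
- case=> // k _ /=.
  rewrite -mulrAC ler_pdivlMr ?subr_gt0//.
  (* [|u - x_(k+1)| <= q |u - x_k| <= q (|u - x_(k+1)| + |x_(k+1) - x_k|)] *)
  have := lin k; have := ler_enorm_dist (x k.+1) u (x k).
  by nra.
Unshelve. all: by end_near. Qed.
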